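(* Let $\mathfrak{R}$ be an elementary divisor domain that is not a field, with field of fractions $\mathbb{F}$. Let $A\in\mathfrak{R}^{n\times n}$, $B\in\mathfrak{R}^{n\times m}$, $C\in\mathfrak{R}^{p\times n}$ and $D\in\mathfrak{R}^{p\times m}$ with $\det A\neq 0$, and let $$P=\begin{bmatrix} A & B\\ C & D\end{bmatrix}\in\mathfrak{R}^{(n+p)\times (n+m)},\qquad G=D-CA^{-1}B\in\mathbb{F}^{p\times m}.$$ Let $S_G \doteq \operatorname{Diag}\left(\frac{\varepsilon_1}{\psi_1},\ldots, \frac{\varepsilon_r}{\psi_r}\right) \oplus 0_{(p-r) \times (m-r)}$ be the Smith-McMillan form of $G$ and let $g$ be the largest index in $\{1,\ldots ,r \}$ such that $\psi_g \notin \mathfrak{R}^\times$ (with $g=0$ if there is none). If $r<n$, set $\psi_i:=1$ for $r+1\le i\le n$. Assume that $A$ and $B$ are not left coprime or that $A$ and $C$ are not right coprime. If the Smith form of $A$ is $S_A \doteq \operatorname{Diag}( \widetilde{\psi}_n , \ldots , \widetilde{\psi}_1 )$ and the Smith form of $P$ is $S_P \doteq \operatorname{Diag}( \widetilde{\varepsilon}_1 , \ldots , \widetilde{\varepsilon}_{n+r} ) \oplus 0_{(p-r) \times (m-r)}$, then: (i) $n \geq g$ and $\psi_i \mid \widetilde{\psi}_i$ for $i= 1, \ldots, n$; (ii) $\displaystyle \frac{\widetilde{\psi}_n \cdots \widetilde{\psi}_2 \, \widetilde{\psi}_1 }{\psi_g \cdots \psi_2 \, \psi_1 } \notin \mathfrak{R}^\times$,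 that is, $\frac{\widetilde{\psi}_i}{\psi_i} \notin \mathfrak{R}^\times$ for at least one $i\in\{1,\dots,n\}$; (iii) $\varepsilon_i \mid \widetilde{\varepsilon}_{n+i}$ for $i=1, \ldots , r$; (iv) $\displaystyle \frac{\widetilde{\varepsilon}_1 \widetilde{\varepsilon}_2 \cdots \widetilde{\varepsilon}_{n+r}}{\varepsilon_1 \varepsilon_2 \cdots \varepsilon_r }$ divides $\displaystyle \frac{\widetilde{\psi}_n \cdots \widetilde{\psi}_2 \, \widetilde{\psi}_1 }{\psi_g \cdots \psi_2 \, \psi_1 }$ in $\mathfrak{R}$; (v) if $r=p=m$ (i.e., $G$ and $P$ are square and nonsingular), then $$\frac{\widetilde{\varepsilon}_1 \widetilde{\varepsilon}_2 \cdots \widetilde{\varepsilon}_{n+r}}{\varepsilon_1 \varepsilon_2 \cdots \varepsilon_{r}} \doteq \frac{\widetilde{\psi}_n \cdots \widetilde{\psi}_2 \, \widetilde{\psi}_1 }{\psi_g \cdots \psi_2 \, \psi_1 } \notin \mathfrak{R}^\times,$$ that is, $\widetilde{\varepsilon}_i \notin \mathfrak{R}^\times$ for at least one $i \in\{ 1, \ldots , n\}$, or $\frac{\widetilde{\varepsilon}_{n+i}}{\varepsilon_i}\notin \mathfrak{R}^\times$ for at least one $i \in\{1, \ldots , r\}$.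
   Context: An elementary divisor domain (EDD) is an integral domain $\mathfrak{R}$ such that every $a,b,c\in\mathfrak{R}$ have a greatest common divisor which can be written $\gcd(a,b,c)=zxa+zyb+wyc$ for some $x,y,z,w\in\mathfrak{R}$; equivalently, an integral domain over which every matrix has a Smith form (defined below). $\mathfrak{R}^\times$ is the group of units. A square matrix over $\mathfrak{R}$ is unimodular if it is invertible over $\mathfrak{R}$. Two matrices $M,N$ of the same size over $\mathbb{F}$ are equivalent if $UMV=N$ with $U,V$ unimodular over $\mathfrak{R}$. Rank is rank over $\mathbb{F}$; one always has $\operatorname{rank}P=n+\operatorname{rank}G$. Smith form of $M\in\mathfrak{R}^{p\times m}$ of rank $r$: a matrix $\operatorname{Diag}(\alpha_1,\dots,\alpha_r)\oplus 0_{(p-r)\times(m-r)}$ equivalent to $M$ with all $\alpha_i\in\mathfrak R$ nonzero and $\alpha_1\mid\alpha_2\mid\cdots\mid\alpha_r$ (the $\alpha_i$ are the invariant factors, unique up to units). Smith-McMillan form of $G\in\mathbb{F}^{p\times m}$ of rank $r$: a matrix $\operatorname{Diag}(\varepsilon_1/\psi_1,\dots,\varepsilon_r/\psi_r)\oplus 0_{(p-r)\times(m-r)}$ equivalent to $G$, with nonzero $\varepsilon_i,\psi_i\in\mathfrak{R}$, $\varepsilon_1\mid\cdots\mid\varepsilon_r$, $\psi_r\mid\cdots\mid\psi_1$ and $\gcd(\varepsilon_i,\psi_i)\doteq 1$ (unique up to units). The symbol $\doteq$ means equality up to multiplication by a unit of $\mathfrak{R}$ (for scalars) or by a diagonal unimodular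 matrix (for matrices); ''the'' Smith(-McMillan) form is understood up to $\doteq$, and its diagonal entries satisfy the stated divisibility chains. Empty products equal $1$. $G_1\in\mathfrak{R}^{p\times m}$ and $G_2\in\mathfrak{R}^{q\times m}$ are right coprime if every $F\in\mathfrak{R}^{m\times m}$ with $G_1=\widetilde G_1F$, $G_2=\widetilde G_2F$ for some matrices $\widetilde G_1,\widetilde G_2$ over $\mathfrak{R}$ is unimodular. $H_1,H_2$ (same number of rows) are left coprime if $H_1^T,H_2^T$ are right coprime. $\oplus$ denotes the block diagonal sum; $0_{0\times q}$ (resp. $0_{p\times 0}$) in a direct sum means appending $q$ zero columns (resp. $p$ zero rows). *)

(* Defs.v *)
From HB Require Import structures.
From mathcomp Require Export all_boot all_order all_algebra fraction.

Set Implicit Arguments.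
Unset Strict Implicit.
Unset Printing Implicit Defensive.

Import GRing.Theory.
Local Open Scope ring_scope.

Notation "x %:F" := (tofrac x) : ring_scope.
Notation "M ^%F" := (map_mx (@tofrac _) M) (at level 2, format "M ^%F") : ring_scope.

Section Scalars.
Variable R : idomainType.
Implicit Types (a b c d e : R) (x y : {fraction R}).

Definition rdivides a b : Prop := exists c, b = c * a.

Definition is_gcd d (s : seq R) : Prop :=
  {in s, forall a, rdivides d a} /\
  (forall e, {in s, forall a, rdivides e a} -> rdivides e d).

Definition elementary_divisor_domain : Prop :=
  forall a b c, exists x y z w : R,
    is_gcd (z * x * a + z * y * b + w * y * c) [:: a; b; c].

(* The next three notions are relative to the subring R of its fraction field. *)
Definition frac_unit x : Prop := exists2 u : R, u \is a GRing.unit & x = u%:F.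

Definition frac_assoc x y : Prop :=
  exists2 u : R, u \is a GRing.unit & x = u%:F * y.

(* Includes the fact that x and y both belong to R. *)
Definition frac_divides x y : Prop :=
  exists a b, [/\ x = a%:F, y = b%:F & rdivides a b].

End Scalars.

(* Diag(a 1, ..., a r) (+) 0_{(p-r) x (m-r)}. Only used with r <= min p m.
   Families are indexed from 1; values outside the range 1..r are irrelevant. *)
Definition diag0 (T : nmodType) (p m r : nat) (a : nat -> T) : 'M[T]_(p, m) :=
  \matrix_(i, j) (if (i == j :> nat) && (i < r)%N then a i.+1 else 0).

Section Matrices.
Variable R : idomainType.

Definition mx_equivalent (p m : nat) (M N : 'M[{fraction R}]_(p, m)) : Prop :=
  exists (U : 'M[R]_p) (V : 'M[R]_m),
    [/\ U \in unitmx, V \in unitmx & U^%F *m M *m V^%F = N].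

Definition right_coprime (p q m : nat) (G1 : 'M[R]_(p, m)) (G2 : 'M[R]_(q, m))
    : Prop :=
  forall F : 'M[R]_m,
    (exists H1 : 'M[R]_(p, m), G1 = H1 *m F) ->
    (exists H2 : 'M[R]_(q, m), G2 = H2 *m F) ->
    F \in unitmx.

Definition left_coprime (n p q : nat) (H1 : 'M[R]_(n, p)) (H2 : 'M[R]_(n, q))
    : Prop :=
  right_coprime H1^T H2^T.

(* The rank condition already forces r <= min p m. *)
Definition smith_form (p m r : nat) (M : 'M[R]_(p, m)) (alpha : nat -> R)
    : Prop :=
  [/\ \rank M^%F = r,
      forall i, (1 <= i <= r)%N -> alpha i != 0,
      forall i, (1 <= i < r)%N -> rdivides (alpha i) (alpha i.+1)
    & mx_equivalent M^%F (diag0 p m r alpha)^%F].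

Definition smith_mcmillan_form (p m r : nat) (G : 'M[{fraction R}]_(p, m))
    (eps psi : nat -> R) : Prop :=
  [/\ \rank G = r,
      forall i, (1 <= i <= r)%N ->
        [/\ eps i != 0, psi i != 0 & is_gcd 1 [:: eps i; psi i]],
      forall i, (1 <= i < r)%N -> rdivides (eps i) (eps i.+1),
      forall i, (1 <= i < r)%N -> rdivides (psi i.+1) (psi i)
    & mx_equivalent G (diag0 p m r (fun i => (eps i)%:F / (psi i)%:F))].

(* The maximum over an empty range is 0. *)
Definition last_nonunit (r : nat) (psi : nat -> R) : nat :=
  \max_(1 <= i < r.+1 | psi i \isn't a GRing.unit) i.

End Matrices.

(* Main.v *)
Require Import Defs.
From mathcomp Require Import all_boot all_order all_algebra fraction perm.
From mathcomp Require Import ring zify.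
From Stdlib Require Import Classical.

(* Over a Bezout domain R, if x I_k = E + y Z with rank E < k, y <> 0 and Z over
   R, then x / y is an eigenvalue of Z, hence integral over R, hence in R. This
   replaces both the theory of determinantal divisors and the reduction to
   coprime realizations.
   - Compressing G = D - C A^-1 B to (eps_i / psi_i) I_i and writing A^-1 as a
     matrix of rank < i plus (1 / tpsi_i) Z gives psi_i | eps_i tpsi_i, so
     psi_i | tpsi_i by coprimality; if i > n, then C A^-1 B itself has rank < i
     and psi_i is a unit.
   - P is the sum of a matrix of rank <= n and of 0 (+) G, so compressing P to
     teps_(n+i) I_(n+i) gives eps_i | teps_(n+i).
   - det (diag (I, X) P diag (I, Y)) = det A * det (X G Y) relates the products
     of invariant factors.
   - Choosing x_i eps_i + y_i psi_i = 1, some X G Y + W with X, Y, W over R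
     equals diag (1 / psi_i); hence psi_1 ... psi_r divides det A1 for every
     realization (A1, B1, C1, D) of G, and a common factor F of A and B (or of A
     and C) gives such an A1 with det A = det F * det A1. *)

Set Implicit Arguments.
Unset Strict Implicit.
Unset Printing Implicit Defensive.

Import GRing.Theory.
Local Open Scope ring_scope.

(** * Bezout identities and integral closedness *)

Section Bezout.
Variable R : idomainType.
Hypothesis R_edd : elementary_divisor_domain R.
Implicit Types a b : R.

Lemma fraction_quotient (x : {fraction R}) :
  exists a b, b != 0 /\ x = a%:F / b%:F.
Proof.
have [y ->] : exists y : {ratio R}, x = \pi_{fraction R}%qT y.
  by exists (repr x); rewrite generic_quotient.reprK.
exists (\n_y), (\d_y); split; first exact: denom_ratioP.
have d0 : (\d_y)%:F != 0 by rewrite tofrac_eq0 denom_ratioP.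
apply: (mulIf d0); rewrite mulfVK //.
unlock FracField.tofrac; rewrite -[LHS]FracField.pi_mul.
apply/eqmodP => /=; rewrite FracField.equivfE /FracField.mulf.
rewrite !numden_Ratio ?(oner_neq0, mulf_neq0, denom_ratioP) //.
by rewrite !mulr1 mulrC.
Qed.

Lemma edd_bezout a b : exists x y, is_gcd (x * a + y * b) [:: a; b].
Proof.
have [x [y [z [w [div_abc gcd_abc]]]]] := R_edd a b 0.
exists (z * x), (z * y); rewrite mulr0 addr0 in div_abc gcd_abc.
split=> [c c_ab | e div_ab].
  by apply: div_abc; move: c_ab; rewrite !inE => /orP[] ->; rewrite ?orbT.
apply: gcd_abc => c; rewrite !inE orbA => /orP[c_ab | /eqP->].
  by apply: div_ab; rewrite !inE.
by exists 0; rewrite mul0r.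
Qed.

Lemma coprime_bezout a b :
  is_gcd 1 [:: a; b] -> exists x y, x * a + y * b = 1.
Proof.
move=> [_ gcd1]; have [x [y [div_ab _]]] := edd_bezout a b.
have [c e1] := gcd1 _ div_ab.
by exists (c * x), (c * y); rewrite -!mulrA -mulrDr.
Qed.

(** Numerator and denominator are divided by a Bezout gcd [d]; cancelling [d] from its own Bezout
    identity makes the reduced terms comaximal. *)
Lemma reduced_quotient (x : {fraction R}) :
  exists a b, [/\ b != 0, x = a%:F / b%:F & exists u v, u * a + v * b = 1].
Proof.
have [a [b [b0 ->]]] := fraction_quotient x.
have [u [v [div_ab _]]] := edd_bezout a b; set d := u * a + v * b in div_ab.
have [a' def_a] : rdivides d a by apply: div_ab; rewrite inE eqxx.
have [b' def_b] : rdivides d b by apply: div_ab; rewrite !inE eqxx orbT.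
have [b'0 d0] : b' != 0 /\ d != 0.
  by apply/andP; rewrite -negb_or -mulf_eq0 -def_b.
exists a', b'; split=> //.
  by rewrite def_a def_b !tofracM -mulf_div divff ?mulr1 // tofrac_eq0.
exists u, v; apply: (mulIf d0); rewrite mul1r mulrDl -!mulrA.
by rewrite -def_a -def_b.
Qed.

(** The determinant is the value at [b] of a polynomial that takes the value 1 at 0. *)
Lemma det_one_sub k (Z : 'M[R]_k) b :
  exists c, \det (1%:M - b *: Z) = 1 + b * c.
Proof.
pose p : {poly R} := \det (1%:M - 'X *: map_mx polyC Z).
have p_at t : p.[t] = \det (1%:M - t *: Z).
  rewrite -[LHS]/(horner_eval t p) -det_map_mx; congr (\det _).
  apply/matrixP=> i j; rewrite !mxE /= /horner_eval !hornerE.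
  by case: (i == j); rewrite ?mulr1n ?mulr0n ?hornerE.
have /factor_theorem[q def_q] : root (p - 1) 0.
  by rewrite rootE !hornerE p_at scale0r subr0 det1 subrr.
exists q.[b]; rewrite -p_at.
have -> : p = 1 + q * ('X - 0%:P) by rewrite -def_q addrC subrK.
by rewrite !hornerE ?subr0 mulrC.
Qed.

(* [x] is an eigenvalue of [Z], hence integral over [R], and a Bezout domain is
   integrally closed. *)
Lemma eigenvalue_integral k (Z : 'M[R]_k) (x : {fraction R}) :
  \det (x%:M - Z^%F) = 0 -> exists c, x = c%:F.
Proof.
have [a [b [b0 -> [u [v uv1]]]]] := reduced_quotient x => det0.
have bF0 : b%:F != 0 by rewrite tofrac_eq0.
have field_id (K : fieldType) (a' b' u' v' z : K) : b' != 0 ->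
    u' * a' + v' * b' - b' * (v' + u' * z) = u' * b' * (a' / b' - z).
  by move=> ?; field.
(* Since [u * a + v * b = 1], this matrix is [u * b] times the singular [(a / b)%:M - Z]. By
   [det_one_sub] its determinant is also [1 + b * c] for some [c], so [b] is a unit. *)
have : \det (1%:M - b *: (v%:M + u *: Z)) = 0.
  apply/eqP; rewrite -tofrac_eq0 -det_map_mx.
  suff -> : (1%:M - b *: (v%:M + u *: Z))^%F =
      (u * b)%:F *: ((a%:F / b%:F)%:M - Z^%F) by rewrite detZ det0 mulr0.
  apply/matrixP=> i j; rewrite !mxE.
  case: (i == j); rewrite ?(mulr1n, mulr0n) -?uv1.
    by rewrite !(tofracM, tofracD, tofracN); apply: field_id.
  rewrite add0r !sub0r tofracN !tofracM !mulrN; congr (- _).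
  by rewrite add0r tofracM mulrA [b%:F * _]mulrC.
have [c ->] := det_one_sub (v%:M + u *: Z) b => /eqP.
rewrite addrC addr_eq0 => /eqP bc; exists (- (a * c)).
apply: (mulIf bF0); rewrite mulfVK // -tofracM mulNr -mulrA [c * b]mulrC.
by rewrite -mulrN bc opprK mulr1.
Qed.

(** Dividing by [y] shows that [(x / y)%:M - Z^%F] is a multiple of the singular [E]. The results
    [pole_dvd], [pole_unit] and [zero_dvd] are all instances. *)
Lemma scalar_low_rank k (Z : 'M[R]_k) (E : 'M[{fraction R}]_k)
    (x y : {fraction R}) :
  y != 0 -> (\rank E < k)%N -> x%:M = E + y *: Z^%F ->
  exists c : R, x = c%:F * y.
Proof.
move=> y0 rkE def_x.
have [|c xy] := @eigenvalue_integral k Z (x / y); last first.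
  by exists c; rewrite -xy mulfVK.
have -> : (x / y)%:M - Z^%F = y^-1 *: E.
  apply: (scalerI y0); rewrite scalerBr scale_scalar_mx mulrC mulfVK //.
  by rewrite def_x addrK scalerA mulfV // scale1r.
apply/eqP; rewrite detZ mulf_eq0 orbC; apply/orP; left.
rewrite -[_ == 0]negbK -unitfE -unitmxE -row_free_unit /row_free.
by rewrite ltn_eqF.
Qed.

End Bezout.

(** * Finite choice and rectangular diagonal matrices *)

Lemma bounded_choice (T : Type) (P : nat -> T -> Prop) n :
  (forall i, (i <= n)%N -> exists x, P i x) ->
  exists f, forall i, (i <= n)%N -> P i (f i).
Proof.
move=> exP; have /fin_all_exists[f fP] (i : 'I_n.+1) : exists x, P i x.
  by apply: exP; rewrite -ltnS.
exists (fun i => f (inord i)) => i le_in.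
by have := fP (inord i); rewrite inordK.
Qed.

Section Diag0.
Variable T : pzRingType.
Implicit Types a b : nat -> T.

Lemma eq_diag0 p m r a b : (forall i, (1 <= i <= r)%N -> a i = b i) ->
  diag0 p m r a = diag0 p m r b.
Proof.
move=> eq_ab; apply/matrixP=> i j; rewrite !mxE; case: ifP => // /andP[_ lt_ir].
exact: eq_ab.
Qed.

(** The side condition keeps the inner dimension from truncating the common diagonal. *)
Lemma mul_diag0 p q m r s a b : (minn r s <= q)%N ->
  diag0 p q r a *m diag0 q m s b = diag0 p m (minn r s) (fun i => a i * b i).
Proof.
move=> le_q; apply/matrixP=> i j; rewrite !mxE leq_min.
have [lt_iq | le_qi] := ltnP i q.
  rewrite (bigD1 (Ordinal lt_iq)) //= big1 ?addr0 => [|l].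
    rewrite !mxE /= eqxx /=; case: (_ == _ :> nat) => /=; last by rewrite mulr0.
    by case: (i < r)%N; case: (i < s)%N; rewrite ?(mul0r, mulr0).
  rewrite -val_eqE /= => ne_li; rewrite mxE eq_sym (negbTE ne_li).
  by rewrite mul0r.
rewrite big1 => [|l _]; last first.
  by rewrite !mxE gtn_eqF ?mul0r // (leq_trans (ltn_ord l)).
by rewrite -leq_min [(i < _)%N]leqNgt ltnS (leq_trans le_q le_qi) andbF.
Qed.

Lemma diag0_1 n : diag0 n n n (fun=> 1 : T) = 1%:M.
Proof.
by apply/matrixP=> i j; rewrite !mxE ltn_ord andbT val_eqE; case: (i == j).
Qed.

(** Factoring through dimension [r] bounds the rank and exposes a square factor for determinants. *)
Lemma diag0_factor p m r a : diag0 p m r a =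
  diag0 p r r (fun=> 1) *m diag0 r r r a *m diag0 r m r (fun=> 1).
Proof.
rewrite !mul_diag0 ?minnn //; apply: eq_diag0 => i _.
by rewrite mul1r mulr1.
Qed.

Lemma diag0_corner p m r a : (r <= p)%N -> (r <= m)%N ->
  diag0 r p r (fun=> 1) *m diag0 p m r a *m diag0 m r r (fun=> 1) = diag0 r r r a.
Proof.
move=> le_rp le_rm; rewrite !mul_diag0 ?minnn //; apply: eq_diag0 => i _.
by rewrite mul1r mulr1.
Qed.

End Diag0.

Lemma det_diag0 (T : comPzRingType) r (a : nat -> T) :
  \det (diag0 r r r a) = \prod_(1 <= i < r.+1) a i.
Proof.
rewrite big_add1 big_mkord /=.
have -> : diag0 r r r a = diag_mx (\row_i a i.+1).
  apply/matrixP=> i j; rewrite !mxE ltn_ord andbT val_eqE.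
  by case: (i == j).
by rewrite det_diag; apply: eq_bigr => i _; rewrite mxE.
Qed.

Lemma rank_diag0 (K : fieldType) p m r (a : nat -> K) :
  (\rank (diag0 p m r a) <= r)%N.
Proof. by rewrite diag0_factor -mulmxA mulmx_max_rank. Qed.

(** * Divisibility chains in the fraction field *)

Section Chains.
Variable R : idomainType.
Implicit Types (a : nat -> {fraction R}) (c : nat -> R).

Lemma map_diag0 p m r c :
  (diag0 p m r c)^%F = diag0 p m r (fun i => (c i)%:F).
Proof. by apply/matrixP=> i j; rewrite !mxE; case: ifP; rewrite ?tofrac0. Qed.

Lemma map_diag0_1 p m r :
  (diag0 p m r (fun=> 1 : R))^%F = diag0 p m r (fun=> 1).
Proof. by rewrite map_diag0 tofrac1. Qed.

(** Entries may be fractions while successive quotients lie in [R]; this covers Smith invariants,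
    the [eps / psi] and the reciprocals of the [tpsi] alike. *)
Definition frac_chain r a :=
  forall i, (1 <= i < r)%N -> exists d : R, a i.+1 = d%:F * a i.

Lemma frac_chain_le r a i j : frac_chain r a ->
  (1 <= i)%N -> (i <= j)%N -> (j <= r)%N -> exists d : R, a j = d%:F * a i.
Proof.
move=> chain_a i1 /subnKC <-; elim: (j - i)%N => [|l IH] le_r.
  by exists 1; rewrite addn0 tofrac1 mul1r.
rewrite addnS in le_r *; have [d def_d] := IH (ltnW le_r).
have [|e ->] := chain_a (i + l)%N; first by rewrite le_r andbT ltn_addr.
by exists (e * d); rewrite def_d tofracM mulrA.
Qed.

(** Each of the first [k] entries divides [a k]: [X] crops to these entries and [Y] scales each of
    them to [a k]. *)
Lemma diag0_head p m r a k : frac_chain r a ->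
    (1 <= k <= r)%N -> (r <= p)%N -> (r <= m)%N ->
  exists (X : 'M[R]_(k, p)) (Y : 'M[R]_(m, k)),
    X^%F *m diag0 p m r a *m Y^%F = (a k)%:M.
Proof.
move=> chain_a /andP[k1 le_kr] le_rp le_rm.
have [|c def_c] := @bounded_choice R
    (fun i d => (1 <= i)%N -> a k = d%:F * a i) k.
  case=> [|i] le_ik; first by exists 0.
  by have [d] := frac_chain_le chain_a (ltn0Sn i) le_ik le_kr; exists d.
exists (diag0 k p k (fun=> 1)), (diag0 m k k c).
rewrite !map_diag0 tofrac1 !mul_diag0 ?(leq_trans (geq_minl _ _)) //; try lia.
rewrite (minn_idPl le_kr) minnn -scalemx1 -diag0_1.
apply/matrixP=> i j; rewrite !mxE ltn_ord andbT mul1r.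
case: (_ == _); last by rewrite mulr0.
by rewrite mulr1 mulrC -def_c.
Qed.

(** The first [k - 1] entries form [E]; the later ones are multiples of [a k] and give [Z]. *)
Lemma diag0_tail p m r a k : frac_chain r a -> (1 <= k <= r)%N ->
  exists (E : 'M[{fraction R}]_(p, m)) (Z : 'M[R]_(p, m)),
    (\rank E < k)%N /\ diag0 p m r a = E + a k *: Z^%F.
Proof.
move=> chain_a /andP[k1 le_kr].
have [|c def_c] := @bounded_choice R
    (fun i d => (k <= i)%N -> a i = d%:F * a k) r.
  move=> i le_ir; have [le_ki | lt_ik] := leqP k i.
    by have [d] := frac_chain_le chain_a k1 le_ki le_ir; exists d.
  by exists 0; lia.
exists (diag0 p m k.-1 a), (diag0 p m r (fun i => if (k <= i)%N then c i else 0)).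
split; first by rewrite (leq_ltn_trans (rank_diag0 _ _ _ _)) // prednK.
apply/matrixP=> i j; rewrite !mxE; case: (_ == _) => /=; last first.
  by rewrite tofrac0 mulr0 addr0.
have [lt_ir | le_ri] := ltnP i r; last first.
  by rewrite tofrac0 mulr0 addr0 ifN // -leqNgt; lia.
have [le_ki | lt_ik] := leqP k i.+1.
  rewrite (def_c _ lt_ir le_ki) mulrC [(i < _)%N]ltnNge.
  by rewrite -ltnS prednK // le_ki add0r.
have -> : (i < k.-1)%N by lia.
by rewrite tofrac0 mulr0 addr0.
Qed.

End Chains.

(** * Schur complements *)

Section Schur.
Variables (K : fieldType) (n m p : nat).
Variables (A : 'M[K]_n) (B : 'M[K]_(n, m)) (C : 'M[K]_(p, n)) (D : 'M[K]_(p, m)).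
Hypothesis A_unit : A \in unitmx.

(** The first summand factors through dimension [n], so the block matrix differs from its
    zero-padded Schur complement by rank at most [n]. *)
Lemma block_mx_schur : block_mx A B C D =
  col_mx A C *m (invmx A *m row_mx A B)
  + col_mx 0 1%:M *m (D - C *m invmx A *m B) *m row_mx 0 1%:M.
Proof.
rewrite [invmx A *m _]mul_mx_row mulVmx // [col_mx 0 _ *m (D - _)]mul_col_mx.
rewrite !mul_col_row add_block_mx.
rewrite !mul0mx !mulmx0 !mulmx1 !mul1mx mulKVmx // !addr0.
by rewrite [C *m (_ *m _)]mulmxA addrCA subrr addr0.
Qed.

End Schur.

Lemma det_block_schur (K : fieldType) n k
    (A : 'M[K]_n) (B : 'M[K]_(n, k)) (C : 'M[K]_(k, n)) (D : 'M[K]_k) :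
  A \in unitmx ->
  \det (block_mx A B C D) = \det A * \det (D - C *m invmx A *m B).
Proof.
move=> A_unit.
have -> : block_mx A B C D =
    block_mx 1%:M 0 (C *m invmx A) 1%:M *m block_mx A B 0 (D - C *m invmx A *m B).
  rewrite mulmx_block !mul1mx !mul0mx !addr0 mulmxKV //.
  by rewrite addrCA subrr addr0.
by rewrite det_mulmx det_lblock det_ublock !det1 !mul1r.
Qed.

(** * Smith and Smith-McMillan forms *)

Section Forms.
Variable R : idomainType.
Local Notation F := {fraction R}.

Lemma map_tofrac_unitmx n (A : 'M[R]_n) : (A^%F \in unitmx) = (\det A != 0).
Proof. by rewrite unitmxE det_map_mx unitfE tofrac_eq0. Qed.

Lemma mx_equivalent_sym p m (M N : 'M[F]_(p, m)) :
  mx_equivalent M N -> mx_equivalent N M.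
Proof.
move=> [U [V [uU uV <-]]]; exists (invmx U), (invmx V).
split; rewrite ?unitmx_inv // !mulmxA -map_mxM mulVmx // map_mx1 mul1mx.
by rewrite -mulmxA -map_mxM mulmxV // map_mx1 mulmx1.
Qed.

Lemma smith_form_det k (M : 'M[R]_k) (a : nat -> R) : smith_form k M a ->
  exists2 u, u \is a GRing.unit & \det M = u * \prod_(1 <= i < k.+1) a i.
Proof.
move=> [_ _ _ /mx_equivalent_sym[U [V [uU uV def_M]]]].
exists (\det U * \det V); first by rewrite unitrM -!unitmxE uU uV.
apply/eqP; rewrite -tofrac_eq -det_map_mx -def_M !det_mulmx !det_map_mx.
by rewrite det_diag0 !tofracM mulrAC.
Qed.

Lemma smith_form_chain p m r (M : 'M[R]_(p, m)) (a : nat -> R) :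
  smith_form r M a -> frac_chain r (fun i => (a i)%:F).
Proof. by move=> [_ _ chain_a _] i /chain_a[c ->]; exists c; rewrite tofracM. Qed.

Lemma smith_form_rank_le p m r (M : 'M[R]_(p, m)) (a : nat -> R) :
  smith_form r M a -> (r <= p)%N /\ (r <= m)%N.
Proof. by move=> [<- _ _ _]; rewrite rank_leq_row rank_leq_col. Qed.

Lemma smith_mcmillan_chain p m r (G : 'M[F]_(p, m)) (eps psi : nat -> R) :
  smith_mcmillan_form r G eps psi ->
  frac_chain r (fun i => (eps i)%:F / (psi i)%:F).
Proof.
move=> [_ nz chain_eps chain_psi _] i /[dup] lt_ir /andP[i1 _].
have [c def_eps] := chain_eps i lt_ir; have [d def_psi] := chain_psi i lt_ir.
have [|_ psi_i _] := nz i; first by lia.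
have [|_ psi_Si _] := nz i.+1; first by lia.
have d0 : d != 0 by apply: contraNneq psi_i; rewrite def_psi => ->; rewrite mul0r.
exists (c * d); rewrite def_eps def_psi !tofracM invfM.
rewrite -!mulrA; congr (_ * _); rewrite mulrCA; congr (_ * _).
by rewrite mulrA mulfV ?mul1r // tofrac_eq0.
Qed.

Lemma smith_mcmillan_rank_le p m r (G : 'M[F]_(p, m)) (eps psi : nat -> R) :
  smith_mcmillan_form r G eps psi -> (r <= p)%N /\ (r <= m)%N.
Proof. by move=> [<- _ _ _]; rewrite rank_leq_row rank_leq_col. Qed.

(** Inversion reverses divisibility, so the reversing permutation [s] lists the reciprocals by
    increasing index, the order in which they form a chain. *)
Lemma inverse_smith_form n (A : 'M[R]_n) (tpsi : nat -> R) :
  smith_form n A (fun i => tpsi (n.+1 - i)%N) ->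
  exists X Y : 'M[R]_n,
    invmx A^%F = X^%F *m diag0 n n n (fun i => (tpsi i)%:F^-1) *m Y^%F.
Proof.
move=> [_ nz _ [U [V [uU uV def_diag]]]].
pose s := perm (@rev_ord_inj n).
exists (V *m perm_mx s), (perm_mx s^-1 *m U).
pose a i : F := (tpsi (n.+1 - i)%N)%:F^-1.
have perm_diag :
    perm_mx s *m diag0 n n n (fun i => (tpsi i)%:F^-1) *m perm_mx s^-1 = diag0 n n n a.
  rewrite -row_permE -col_permE; apply/matrixP=> i j.
  rewrite !mxE !permE !ltn_ord !andbT !val_eqE (inj_eq rev_ord_inj).
  by rewrite /a /= subnSK.
have right_inv : U^%F *m (A^%F *m (V^%F *m diag0 n n n a)) = 1%:M.
  rewrite !mulmxA def_diag map_diag0 mul_diag0 minnn // -diag0_1.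
  apply: eq_diag0 => i i_range.
  by rewrite mulfV // tofrac_eq0 nz.
rewrite !map_mxM !map_perm_mx -!mulmxA [perm_mx s *m _]mulmxA.
rewrite [perm_mx s *m _ *m _]mulmxA perm_diag.
(* Moving [U] from the left end to the right end of [right_inv] leaves [A] times its inverse. *)
have := mulmx1C right_inv; rewrite -!mulmxA => /[dup] /mulmx1_unit[uA _] AX1.
by rewrite -[LHS]mulmx1 -AX1 mulKmx.
Qed.

Lemma inverse_smith_chain n (A : 'M[R]_n) (tpsi : nat -> R) :
  smith_form n A (fun i => tpsi (n.+1 - i)%N) ->
  frac_chain n (fun i => (tpsi i)%:F^-1).
Proof.
move=> [_ nz chain _] i /andP[i1 lt_in].
have [|c] := chain (n - i)%N; first by lia.
(* At position [n - i] the Smith form of [A] holds [tpsi i.+1], followed by [tpsi i]. *)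
have [-> ->] : (n.+1 - (n - i) = i.+1 /\ n.+1 - (n - i).+1 = i)%N by lia.
move=> def_t; have : tpsi i != 0.
  by have := nz (n.+1 - i)%N; rewrite subKn ?(ltnW (leqW lt_in)) //; apply; lia.
rewrite def_t mulf_eq0 negb_or => /andP[c0 t0]; exists c.
by rewrite tofracM invfM mulrA mulfV ?mul1r // tofrac_eq0.
Qed.

(** At most [k] entries are nonzero, so the product splits into square factors of size [k] and no
    Cauchy-Binet sum arises. *)
Lemma det_mul_diag0 k p m (X : 'M[R]_(k, p)) (Y : 'M[R]_(m, k)) (a : nat -> F) :
  exists c : R,
    \det (X^%F *m diag0 p m k a *m Y^%F) = c%:F * \prod_(1 <= i < k.+1) a i.
Proof.
exists (\det (X *m diag0 p k k (fun=> 1)) * \det (diag0 k m k (fun=> 1) *m Y)).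
rewrite tofracM -!det_map_mx !map_mxM !map_diag0_1 mulrAC -det_diag0.
by rewrite -!det_mulmx (diag0_factor p m k a) !mulmxA.
Qed.

End Forms.

(** * Determinants of compressed realizations *)

Section Realization.
Variable R : idomainType.
Variables (n m p : nat) (A : 'M[R]_n) (B : 'M[R]_(n, m)).
Variables (C : 'M[R]_(p, n)) (D : 'M[R]_(p, m)).
Hypothesis detA : \det A != 0.
Local Notation G := (D^%F - C^%F *m invmx A^%F *m B^%F).

(** Compressing [G] and adding an integral [W] gives a Schur complement over the same [A]; hence
    [\det A] clears the denominator of each such determinant. *)
Lemma det_realization k (X : 'M[R]_(k, p)) (Y : 'M[R]_(m, k)) (W : 'M[R]_k) :
  (\det A)%:F * \det (X^%F *m G *m Y^%F + W^%F) =
    (\det (block_mx A (B *m Y) (X *m C) (X *m D *m Y + W)))%:F.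
Proof.
rewrite -[RHS]det_map_mx map_block_mx det_block_schur ?map_tofrac_unitmx //.
rewrite det_map_mx !(map_mxM, map_mxD) /=; congr (_ * \det _).
by rewrite mulmxBr mulmxBl addrAC !mulmxA.
Qed.

End Realization.

Lemma mulmx_rank_sandwich (K : fieldType) k l p m
    (X : 'M[K]_(k, p)) (E : 'M[K]_(p, m)) (Y : 'M[K]_(m, l)) :
  (\rank (X *m E *m Y) <= \rank E)%N.
Proof. exact: leq_trans (mxrankM_maxl _ _) (mxrankM_maxr _ _). Qed.

(** * Divisibility of poles, zeros and their products *)

Section Divisibility.
Variable R : idomainType.
Hypothesis R_edd : elementary_divisor_domain R.
Variables (n m p r : nat) (A : 'M[R]_n) (B : 'M[R]_(n, m)).
Variables (C : 'M[R]_(p, n)) (D : 'M[R]_(p, m)).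
Hypothesis detA : \det A != 0.
Local Notation G := (D^%F - C^%F *m invmx A^%F *m B^%F).
Variables eps psi : nat -> R.
Hypothesis S_G : smith_mcmillan_form r G eps psi.

(** Euclid's lemma applied to [e * t = c * q]. *)
Lemma quotient_dvd_coprime (e q t c : R) : is_gcd 1 [:: e; q] ->
  q != 0 -> t != 0 -> e%:F / q%:F = c%:F / t%:F -> rdivides q t.
Proof.
move=> /(coprime_bezout R_edd)[x [y xy1]] q0 t0 /eqP.
rewrite eqr_div ?tofrac_eq0 // -!tofracM tofrac_eq => /eqP et_cq.
exists (x * c + y * t).
by rewrite -[t in LHS]mul1r -xy1 !mulrDl -!mulrA et_cq [q * t]mulrC.
Qed.

Lemma smith_mcmillan_scalar k : (1 <= k <= r)%N ->
  exists (X : 'M[R]_(k, p)) (Y : 'M[R]_(m, k)),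
    X^%F *m G *m Y^%F = ((eps k)%:F / (psi k)%:F)%:M.
Proof.
move=> k_range; have [le_rp le_rm] := smith_mcmillan_rank_le S_G.
have [_ _ _ _ [U [V [_ _ def_diag]]]] := S_G.
have [X [Y def_eps]] := diag0_head (smith_mcmillan_chain S_G) k_range le_rp le_rm.
by exists (X *m U), (V *m Y); rewrite -def_eps -def_diag !map_mxM !mulmxA.
Qed.

(** Even for rectangular [G], the nonzero invariants fill a square corner, where determinants
    apply. *)
Lemma smith_mcmillan_corner : exists (X : 'M[R]_(r, p)) (Y : 'M[R]_(m, r)),
  X^%F *m G *m Y^%F = diag0 r r r (fun i => (eps i)%:F / (psi i)%:F).
Proof.
have [le_rp le_rm] := smith_mcmillan_rank_le S_G.
have [_ _ _ _ [U [V [_ _ def_diag]]]] := S_G.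
exists (diag0 r p r (fun=> 1) *m U), (V *m diag0 m r r (fun=> 1)).
rewrite -(diag0_corner _ le_rp le_rm) -def_diag !map_mxM !map_diag0_1.
by rewrite !mulmxA.
Qed.

Lemma pole_dvd (tpsi : nat -> R) i :
  smith_form n A (fun i => tpsi (n.+1 - i)%N) ->
  (1 <= i <= r)%N -> (i <= n)%N -> rdivides (psi i) (tpsi i).
Proof.
move=> S_A i_range le_in; have /andP[i1 _] := i_range.
have [_ nz _ _ _] := S_G; have [_ psi0 cop] := nz i i_range.
have t0 : tpsi i != 0.
  have [_ nzA _ _] := S_A; have := nzA (n.+1 - i)%N.
  by rewrite subKn ?leqW //; apply; lia.
have [X [Y XGY]] := smith_mcmillan_scalar i_range.
have [X1 [Y1 def_invA]] := inverse_smith_form S_A.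
have [|E [Z [rkE def_diag]]] := diag0_tail n n (inverse_smith_chain S_A) (k := i).
  by rewrite i1.
have tF0 : (tpsi i)%:F != 0 by rewrite tofrac_eq0.
pose L := X *m C *m X1; pose N := Y1 *m B *m Y.
(* The compression of [G] is [X D Y - L (E + Z / tpsi_i) N]; scaling the integral term [X D Y] by
   [tpsi i] lets everything but [E] carry the factor [1 / tpsi_i]. *)
have [|||c] := @scalar_low_rank R R_edd i (tpsi i *: (X *m D *m Y) - L *m Z *m N)
    (- (L^%F *m E *m N^%F)) ((eps i)%:F / (psi i)%:F) (tpsi i)%:F^-1.
- by rewrite invr_eq0.
- by rewrite -scaleN1r (leq_ltn_trans (mxrankS (scalemx_sub _ (submx_refl _)))) //
    (leq_ltn_trans (mulmx_rank_sandwich _ _ _)).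
- rewrite -XGY def_invA def_diag map_mxB map_mxZ !map_mxM.
  rewrite scalerBr scalerA mulVf // scale1r.
  rewrite mulmxBr mulmxBl addrCA; congr (_ + _).
  by rewrite !(mulmxDr, mulmxDl) opprD !(=^~ scalemxAl, =^~ scalemxAr) !mulmxA.
exact: quotient_dvd_coprime cop psi0 t0.
Qed.

Lemma pole_unit i : (1 <= i <= r)%N -> (n < i)%N -> psi i \is a GRing.unit.
Proof.
move=> i_range lt_ni.
have [_ nz _ _ _] := S_G; have [_ psi0 cop] := nz i i_range.
have [X [Y XGY]] := smith_mcmillan_scalar i_range.
(* The term in [invmx A] factors through dimension [n < i], so it serves as the low-rank part, with
   [y = 1]. *)
have [|||c] := @scalar_low_rank R R_edd i (X *m D *m Y)
    (- ((X *m C)^%F *m (invmx A^%F *m B^%F *m Y^%F))) ((eps i)%:F / (psi i)%:F) 1.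
- exact: oner_neq0.
- by rewrite -mulNmx (leq_ltn_trans (mulmx_max_rank _ _)).
- by rewrite -XGY scale1r !map_mxM mulmxBr mulmxBl addrC !mulmxA.
rewrite -[1 in RHS]invr1 -tofrac1 => /(quotient_dvd_coprime cop psi0 (oner_neq0 _)).
by move=> [d d_inv]; apply/unitrP; exists d; rewrite -d_inv mulrC -d_inv.
Qed.

Lemma zero_dvd (teps : nat -> R) i :
  smith_form (n + r) (block_mx A B C D) teps ->
  (1 <= i <= r)%N -> rdivides (eps i) (teps (n + i)%N).
Proof.
move=> S_P i_range; have /andP[i1 le_ir] := i_range.
have [_ nz _ _ /mx_equivalent_sym[U [V [_ _ def_G]]]] := S_G.
have [eps0 psi0 cop] := nz i i_range.
have [le_rp le_rm] := smith_form_rank_le S_P.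
have [|X0 [Y0 def_teps]] :=
    diag0_head (smith_form_chain S_P) (k := (n + i)%N) _ le_rp le_rm.
  by rewrite leq_add2l le_ir addn_gt0 i1 orbT.
have [_ _ _ [U1 [V1 [_ _ def_diagP]]]] := S_P.
have [E [Z [rkE def_diag]]] := diag0_tail p m (smith_mcmillan_chain S_G) i_range.
pose X := X0 *m U1; pose Y := V1 *m Y0.
pose L := X *m col_mx 0 1%:M *m U; pose N := V *m row_mx 0 1%:M *m Y.
(* The Schur splitting contributes rank at most [n] and [E] less than [i], which stays below the
   size [n + i]. *)
have [|||c] := @scalar_low_rank R R_edd (n + i) (L *m Z *m N)
   (X^%F *m col_mx A^%F C^%F *m (invmx A^%F *m row_mx A^%F B^%F *m Y^%F)
     + L^%F *m E *m N^%F) (teps (n + i)%N)%:F ((eps i)%:F / (psi i)%:F).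
- by rewrite mulf_neq0 ?invr_eq0 ?tofrac_eq0.
- rewrite (leq_ltn_trans (mxrank_add _ _)) // -addnS leq_add ?mulmx_max_rank //.
  exact: leq_ltn_trans (mulmx_rank_sandwich _ _ _) rkE.
- rewrite -def_teps -map_diag0 -def_diagP map_block_mx.
  rewrite block_mx_schur ?map_tofrac_unitmx // -def_G def_diag.
  rewrite /L /N /X /Y !map_mxM map_col_mx map_row_mx !map_mx0 !map_mx1.
  by rewrite !(mulmxDr, mulmxDl) -addrA !(=^~ scalemxAl, =^~ scalemxAr) !mulmxA.
move=> def_te; have [x [y xy1]] := coprime_bezout R_edd cop.
have : teps (n + i)%N * psi i = c * eps i.
  apply/eqP; rewrite -tofrac_eq !tofracM def_te.
  by rewrite -!mulrA mulVf ?mulr1 // tofrac_eq0.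
move=> tp_ce; exists (x * teps (n + i)%N + y * c).
rewrite -[LHS]mul1r -xy1.
have -> : (x * eps i + y * psi i) * teps (n + i)%N =
  x * teps (n + i)%N * eps i + y * (teps (n + i)%N * psi i) by ring.
by rewrite tp_ce; ring.
Qed.

(** As this holds for every realization of [G], it also constrains the denominator left after
    removing a common factor. *)
Lemma pole_prod_dvd_det : rdivides (\prod_(1 <= i < r.+1) psi i) (\det A).
Proof.
have [_ nz _ _ _] := S_G.
have [|xy def_xy] := @bounded_choice (R * R)
  (fun i xy => (1 <= i)%N -> xy.1 * eps i + xy.2 * psi i = 1) r.
  case=> [|i] le_ir; first by exists (0, 0).
  have [_ _ /(coprime_bezout R_edd)[x [y xy1]]] := nz i.+1 le_ir.
  by exists (x, y).
have [X [Y XGY]] := smith_mcmillan_corner.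
pose x := diag0 r r r (fun i => (xy i).1); pose y := diag0 r r r (fun i => (xy i).2).
have := det_realization B C D detA (x *m X) Y y; set M := block_mx _ _ _ _.
(* Entrywise, [x * (eps / psi) + y = (x * eps + y * psi) / psi = 1 / psi]. *)
have -> : (x *m X)^%F *m G *m Y^%F + y^%F = diag0 r r r (fun i => (psi i)%:F^-1).
  rewrite map_mxM -!(mulmxA x^%F) XGY /x /y !map_diag0 mul_diag0 minnn //.
  apply/matrixP=> i j; rewrite !mxE; case: ifP => [/andP[_ lt_ir] | _]; last exact: addr0.
  have [_ psi0 _] := nz i.+1 lt_ir.
  have pF0 : (psi i.+1)%:F != 0 by rewrite tofrac_eq0.
  apply: (mulIf pF0); rewrite mulVf // mulrDl mulrA mulfVK //.
  by rewrite -!tofracM -tofracD def_xy.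
rewrite det_diag0 prodfV => detM; exists (\det M).
apply/eqP; rewrite -tofrac_eq tofracM -detM rmorph_prod mulfVK //.
rewrite prodf_seq_neq0; apply/allP => i; rewrite mem_index_iota ltnS => i_range.
by have [_ psi0 _] := nz i i_range; rewrite tofrac_eq0.
Qed.

(** [\det A] times the determinant of the corner of [G] is the determinant of a compression of the
    block matrix to size [n + r], hence a multiple of the product of the [teps]. *)
Lemma zero_prod_dvd (teps : nat -> R) :
  smith_form (n + r) (block_mx A B C D) teps ->
  exists c : R, \det A * \prod_(1 <= i < r.+1) eps i =
    c * (\prod_(1 <= i < (n + r).+1) teps i) * \prod_(1 <= i < r.+1) psi i.
Proof.
move=> [_ _ _ /mx_equivalent_sym[U [V [_ _ def_P]]]].
have [X [Y XGY]] := smith_mcmillan_corner.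
have := det_realization B C D detA X Y 0; rewrite map_mx0 !addr0 XGY det_diag0.
have -> : block_mx A (B *m Y) (X *m C) (X *m D *m Y) =
    block_mx 1%:M 0 0 X *m block_mx A B C D *m block_mx 1%:M 0 0 Y.
  by rewrite !mulmx_block !(mul1mx, mulmx1, mul0mx, mulmx0, addr0, add0r).
rewrite -[RHS]det_map_mx !map_mxM -def_P map_diag0 !mulmxA -map_mxM -mulmxA -map_mxM.
have [c ->] := det_mul_diag0 (block_mx 1%:M 0 0 X *m U) (V *m block_mx 1%:M 0 0 Y)
  (fun i => (teps i)%:F).
rewrite prodf_div mulrA => eq_det; exists c; apply/eqP.
rewrite -tofrac_eq !tofracM !rmorph_prod -eq_det mulfVK //.
have [_ nz _ _ _] := S_G.
rewrite prodf_seq_neq0; apply/allP => i; rewrite mem_index_iota ltnS => i_range.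
by have [_ psi0 _] := nz i i_range; rewrite tofrac_eq0.
Qed.

End Divisibility.

(** * The square nonsingular case *)

Section Square.
Variable R : idomainType.

(** Nothing is cropped here: only unimodular factors intervene, so the constant of [zero_prod_dvd]
    becomes a unit. *)
Lemma zero_prod_assoc n r (A : 'M[R]_n) (B : 'M[R]_(n, r)) (C : 'M[R]_(r, n))
    (D : 'M[R]_r) (eps psi teps : nat -> R) :
  \det A != 0 ->
  smith_mcmillan_form r (D^%F - C^%F *m invmx A^%F *m B^%F) eps psi ->
  smith_form (n + r) (block_mx A B C D) teps ->
  exists2 c, c \is a GRing.unit & \det A * \prod_(1 <= i < r.+1) eps i =
    c * (\prod_(1 <= i < (n + r).+1) teps i) * \prod_(1 <= i < r.+1) psi i.
Proof.
move=> detA [_ nz _ _ [U [V [uU uV def_diag]]]] /smith_form_det[u u_unit detP].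
move: def_diag => /(congr1 determinant); rewrite !det_mulmx det_diag0 prodf_div.
set g := \det (_ - _) => def_g.
have : (\det A)%:F * g = (u * \prod_(1 <= i < (n + r).+1) teps i)%:F.
  rewrite -detP -[RHS]det_map_mx map_block_mx det_block_schur ?map_tofrac_unitmx //.
  by rewrite det_map_mx.
move=> def_Ag; exists (\det U * \det V * u).
  by rewrite !unitrM -!unitmxE uU uV.
apply/eqP; rewrite -tofrac_eq !tofracM !rmorph_prod.
have psi0 : \prod_(1 <= i < r.+1) (psi i)%:F != 0.
  rewrite prodf_seq_neq0; apply/allP => i; rewrite mem_index_iota ltnS => i_range.
  by have [_ psi0 _] := nz i i_range; rewrite tofrac_eq0.
apply/eqP; apply: (canRL (mulfVK psi0)); rewrite /= -[LHS]mulrA -def_g.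
rewrite tofracM rmorph_prod in def_Ag.
rewrite !det_map_mx -[RHS]mulrA -def_Ag /= mulrCA -!mulrA; congr (_ * _).
by rewrite mulrCA [RHS]mulrCA [g * _]mulrC.
Qed.

End Square.

(** * Common factors and minimality of [\det A] *)

Lemma invmx_factorl (K : fieldType) n m (H A : 'M[K]_n) (B : 'M[K]_(n, m)) :
  H \in unitmx -> A \in unitmx ->
  invmx (H *m A) *m (H *m B) = invmx A *m B.
Proof.
move=> H_unit A_unit; have HA_unit : H *m A \in unitmx.
  by rewrite unitmx_mul H_unit.
apply: (can_inj (mulKmx HA_unit)).
by rewrite (mulKVmx HA_unit) -mulmxA (mulKVmx A_unit).
Qed.

Lemma invmx_factorr (K : fieldType) n p (A H : 'M[K]_n) (C : 'M[K]_(p, n)) :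
  A \in unitmx -> H \in unitmx ->
  C *m H *m invmx (A *m H) = C *m invmx A.
Proof.
move=> A_unit H_unit; have AH_unit : A *m H \in unitmx.
  by rewrite unitmx_mul A_unit.
apply: (can_inj (mulmxK AH_unit)).
rewrite -[LHS]mulmxA (mulVmx AH_unit) mulmx1 [RHS]mulmxA.
by rewrite -[C *m _ *m A]mulmxA (mulVmx A_unit) mulmx1.
Qed.

Section Coprimality.
Variable R : idomainType.
Hypothesis R_edd : elementary_divisor_domain R.
Variables (n m p r : nat) (A : 'M[R]_n) (B : 'M[R]_(n, m)).
Variables (C : 'M[R]_(p, n)) (D : 'M[R]_(p, m)) (eps psi : nat -> R).
Hypothesis detA : \det A != 0.
Local Notation pole_prod := (\prod_(1 <= i < r.+1) psi i).
Hypothesis S_G :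
  smith_mcmillan_form r (D^%F - C^%F *m invmx A^%F *m B^%F) eps psi.

(** Here [f] stands for the determinant of a common factor and [c * pole_prod] for that of the
    reduced denominator. *)
Lemma det_factor_unit (u c f : R) : u \is a GRing.unit ->
  \det A = u * pole_prod -> \det A = f * (c * pole_prod) -> f \is a GRing.unit.
Proof.
move=> u_unit def_uA def_fA.
have pole0 : pole_prod != 0.
  by move: detA; rewrite def_uA mulf_eq0 negb_or => /andP[].
have def_u : u = f * c.
  by apply: (mulIf pole0); rewrite -def_uA def_fA mulrA.
by move: u_unit; rewrite def_u unitrM => /andP[].
Qed.

(** Cancelling a common left factor [H^T] keeps [G], so the determinant of the reduced denominator
    is still a multiple of [pole_prod]; only a unit remains for [\det H]. *)
Lemma minimal_left_coprime u : u \is a GRing.unit ->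
  \det A = u * pole_prod -> left_coprime A B.
Proof.
move=> u_unit def_uA H [A1 /(congr1 trmx)] + [B1 /(congr1 trmx)].
rewrite !trmxK !trmx_mul => def_A def_B.
have detA1 : \det A1^T != 0.
  by move: detA; rewrite def_A det_mulmx mulf_eq0 negb_or => /andP[].
have detH : \det H^T != 0.
  by move: detA; rewrite def_A det_mulmx mulf_eq0 negb_or => /andP[].
have invA : invmx A^%F *m B^%F = invmx A1^T^%F *m B1^T^%F.
  by rewrite def_A def_B !map_mxM; apply: invmx_factorl; rewrite map_tofrac_unitmx.
move: S_G; rewrite -mulmxA invA mulmxA => /(pole_prod_dvd_det R_edd detA1)[c def_A1].
rewrite unitmxE -det_tr; apply: (det_factor_unit (c := c) u_unit def_uA).
by rewrite {1}def_A det_mulmx def_A1.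
Qed.

Lemma minimal_right_coprime u : u \is a GRing.unit ->
  \det A = u * pole_prod -> right_coprime A C.
Proof.
move=> u_unit def_uA H [A1 def_A] [C1 def_C].
have [detA1 detH] : \det A1 != 0 /\ \det H != 0.
  by apply/andP; move: detA; rewrite def_A det_mulmx mulf_eq0 negb_or.
have invA : C^%F *m invmx A^%F = C1^%F *m invmx A1^%F.
  by rewrite def_A def_C !map_mxM; apply: invmx_factorr; rewrite map_tofrac_unitmx.
move: S_G; rewrite invA => /(pole_prod_dvd_det R_edd detA1)[c def_A1].
rewrite unitmxE; apply: (det_factor_unit (c := c) u_unit def_uA).
by rewrite {1}def_A det_mulmx def_A1 mulrC.
Qed.

End Coprimality.

(** * Units and products of scalars *)

Section Products.
Variable R : idomainType.
Implicit Types (a b : nat -> R) (x y : {fraction R}).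

Lemma frac_unit_mul x y : frac_unit x -> frac_unit y -> frac_unit (x * y).
Proof.
move=> [u u_unit ->] [v v_unit ->].
by exists (u * v); rewrite ?unitrM ?u_unit // tofracM.
Qed.

Lemma frac_unitE (u : R) : frac_unit u%:F <-> u \is a GRing.unit.
Proof.
split=> [[v v_unit /eqP] | u_unit]; last by exists u.
by rewrite tofrac_eq => /eqP->.
Qed.

Lemma frac_unit_prod m k (f : nat -> {fraction R}) :
  (forall i, (m <= i < k)%N -> frac_unit (f i)) ->
  frac_unit (\prod_(m <= i < k) f i).
Proof.
move=> f_unit; rewrite big_nat; elim/big_ind: _ => //; last exact: frac_unit_mul.
by exists 1; rewrite ?unitr1 ?tofrac1.
Qed.

Lemma rdivides_prod m k a b :
  (forall i, (m <= i < k)%N -> rdivides (a i) (b i)) ->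
  rdivides (\prod_(m <= i < k) a i) (\prod_(m <= i < k) b i).
Proof.
move=> div_ab; rewrite !big_nat; elim/big_ind2: _ => //.
  by exists 1; rewrite mul1r.
move=> x1 x2 y1 y2 [c ->] [d ->]; exists (c * d); exact: mulrACA.
Qed.

Lemma last_nonunit_unit r a i :
  (last_nonunit r a < i <= r)%N -> a i \is a GRing.unit.
Proof.
case: i => [|i] /andP[lt_gi le_ir] //; apply: contraLR lt_gi => nunit.
by rewrite -leqNgt; apply: (@leq_bigmax_seq _ _ _ id); rewrite ?mem_index_iota.
Qed.

Lemma last_nonunit_le r a k :
  (forall i, (1 <= i <= r)%N -> (k < i)%N -> a i \is a GRing.unit) ->
  (last_nonunit r a <= k)%N.
Proof.
move=> a_unit; apply/bigmax_leqP_seq => i; rewrite mem_index_iota ltnS => i_range.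
by apply: contraR; rewrite -ltnNge; apply: a_unit.
Qed.

Lemma prod_unit_tail g k a : (g <= k)%N ->
  (forall i, (g < i <= k)%N -> a i \is a GRing.unit) ->
  exists2 u, u \is a GRing.unit &
    \prod_(1 <= i < k.+1) a i = u * \prod_(1 <= i < g.+1) a i.
Proof.
move=> le_gk a_unit; exists (\prod_(g.+1 <= i < k.+1) a i).
  rewrite big_nat; apply: rpred_prod => i i_range; exact: a_unit.
by rewrite (big_cat_nat (n := g.+1)) //= mulrC.
Qed.

Lemma prod_nat_addn n r a : \prod_(1 <= i < (n + r).+1) a i =
  (\prod_(1 <= i < n.+1) a i) * \prod_(1 <= i < r.+1) a (n + i)%N.
Proof.
elim: r => [|r IHr]; first by rewrite addn0 [X in _ * X]big_geq ?mulr1.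
by rewrite addnS !(big_nat_recr _.+1) //= IHr addnS mulrA.
Qed.

End Products.

(** * The five claims, assembled from the divisibilities and determinant identities *)

Theorem theorem4p7 (R : idomainType)
  (R_edd : elementary_divisor_domain R)
  (R_not_field : ~ GRing.field_axiom R)
  (n m p r : nat)
  (A : 'M[R]_n) (B : 'M[R]_(n, m)) (C : 'M[R]_(p, n)) (D : 'M[R]_(p, m))
  (detA : \det A != 0)
  (P : 'M[R]_(n + p, n + m)) (P_def : P = block_mx A B C D)
  (G : 'M[{fraction R}]_(p, m))
  (G_def : G = D^%F - C^%F *m invmx A^%F *m B^%F)
  (eps psi tpsi teps : nat -> R)
  (S_G : smith_mcmillan_form r G eps psi)
  (g : nat) (g_def : g = last_nonunit r psi)
  (psi_ext : forall i, (r < i <= n)%N -> psi i = 1)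
  (not_coprime : ~ left_coprime A B \/ ~ right_coprime A C)
  (S_A : smith_form n A (fun i => tpsi (n.+1 - i)%N))
  (S_P : smith_form (n + r) P teps) :
  let eps_ratio : {fraction R} :=
    (\prod_(1 <= i < (n + r).+1) teps i)%:F / (\prod_(1 <= i < r.+1) eps i)%:F in
  let psi_ratio : {fraction R} :=
    (\prod_(1 <= i < n.+1) tpsi i)%:F / (\prod_(1 <= i < g.+1) psi i)%:F in
  [/\ (g <= n)%N /\ (forall i, (1 <= i <= n)%N -> rdivides (psi i) (tpsi i)),
      ~ frac_unit psi_ratio /\
      (exists2 i, (1 <= i <= n)%N & ~ frac_unit ((tpsi i)%:F / (psi i)%:F)),
      forall i, (1 <= i <= r)%N -> rdivides (eps i) (teps (n + i)%N),
      frac_divides eps_ratio psi_ratio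
    & r = p -> p = m ->
      [/\ frac_assoc eps_ratio psi_ratio, ~ frac_unit psi_ratio
        & (exists2 i, (1 <= i <= n)%N & teps i \isn't a GRing.unit) \/
          (exists2 i, (1 <= i <= r)%N &
             ~ frac_unit ((teps (n + i)%N)%:F / (eps i)%:F))]].
Proof.
move=> eps_ratio psi_ratio; subst P G.
have [_ nz _ _ _] := S_G.
have psi_unit i : (g < i)%N -> (i <= n)%N || (i <= r)%N -> psi i \is a GRing.unit.
  move=> lt_gi; have [le_ir _ | lt_ri] := leqP i r.
    by apply: (@last_nonunit_unit _ r); rewrite -g_def lt_gi.
  by rewrite orbF => le_in; rewrite psi_ext ?unitr1 // lt_ri.
have le_gn : (g <= n)%N.
  by rewrite g_def; apply: last_nonunit_le; exact: (pole_unit R_edd S_G).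
have le_gr : (g <= r)%N.
  by rewrite g_def; apply: last_nonunit_le => i; lia.
have psi_dvd i : (1 <= i <= n)%N -> rdivides (psi i) (tpsi i).
  move=> /andP[i1 le_in]; have [le_ir | lt_ri] := leqP i r.
    by apply: (pole_dvd R_edd detA S_G S_A _ le_in); rewrite i1.
  by exists (tpsi i); rewrite psi_ext ?mulr1 // lt_ri.
have eps_dvd i : (1 <= i <= r)%N -> rdivides (eps i) (teps (n + i)%N).
  exact: (zero_dvd R_edd detA S_G S_P).
(* The product of the [psi] is needed up to [n] against the [tpsi] and up to [r] against [S_G]; both
   differ from the product up to [g] by units. *)
have [wn wn_unit psi_prod_n] := prod_unit_tail le_gn (a := psi)
  (fun i h => psi_unit i (proj1 (andP h)) (introT orP (or_introl (proj2 (andP h))))).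
have [wr wr_unit psi_prod_r] := prod_unit_tail le_gr (a := psi)
  (fun i h => psi_unit i (proj1 (andP h)) (introT orP (or_intror (proj2 (andP h))))).
have [w w_unit def_detA] := smith_form_det S_A.
have tpsi_rev : \prod_(1 <= i < n.+1) tpsi (n.+1 - i)%N = \prod_(1 <= i < n.+1) tpsi i.
  rewrite [RHS]big_nat_rev; apply: eq_bigr => i _; congr (tpsi _); lia.
rewrite tpsi_rev in def_detA.
have prod_neq0 k (a : nat -> R) : (forall i, (1 <= i <= k)%N -> a i != 0) ->
    \prod_(1 <= i < k.+1) a i != 0.
  move=> a0; rewrite prodf_seq_neq0; apply/allP => i.
  by rewrite mem_index_iota => /a0.
have psi0 : \prod_(1 <= i < g.+1) psi i != 0.
  apply: prod_neq0 => i /andP[i1 le_ig].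
  by have [|_ ? _] := nz i; rewrite // i1 (leq_trans le_ig).
have eps0 : \prod_(1 <= i < r.+1) eps i != 0.
  by apply: prod_neq0 => i /nz[].
have [b def_b] : rdivides (\prod_(1 <= i < g.+1) psi i) (\prod_(1 <= i < n.+1) tpsi i).
  have [c ->] := rdivides_prod psi_dvd (m := 1) (k := n.+1).
  by exists (c * wn); rewrite psi_prod_n mulrA.
have [a def_a] : rdivides (\prod_(1 <= i < r.+1) eps i) (\prod_(1 <= i < (n + r).+1) teps i).
  have [c eps_c] : rdivides (\prod_(1 <= i < r.+1) eps i)
      (\prod_(1 <= i < r.+1) teps (n + i)%N) by apply: rdivides_prod.
  by exists (\prod_(1 <= i < n.+1) teps i * c); rewrite prod_nat_addn eps_c mulrA.
have psi_ratioE : psi_ratio = b%:F.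
  by rewrite /psi_ratio def_b tofracM mulfK // tofrac_eq0.
have eps_ratioE : eps_ratio = a%:F.
  by rewrite /eps_ratio def_a tofracM mulfK // tofrac_eq0.
(* With [psi_ratio] and [eps_ratio] now the ring elements [b] and [a], both product identities
   reduce to this relation. *)
have cancel_prods c : \det A * \prod_(1 <= i < r.+1) eps i =
    c * (\prod_(1 <= i < (n + r).+1) teps i) * \prod_(1 <= i < r.+1) psi i ->
    w * b = c * wr * a.
  rewrite def_detA def_b psi_prod_r def_a => eq_prods.
  apply: (mulIf psi0); apply: (mulIf eps0); rewrite -[w * b * _]mulrA eq_prods.
  by ring.
(* A unit [b] would make [\det A] associate to the product of the [psi], which forces both
   coprimality conditions. *)
have b_nonunit : b \isn't a GRing.unit.
  apply/negP => b_unit.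
  have def_uA : \det A = w * b / wr * \prod_(1 <= i < r.+1) psi i.
    by rewrite def_detA def_b psi_prod_r [RHS]mulrA mulrVK // mulrA.
  have u_unit : w * b / wr \is a GRing.unit by rewrite !unitrM w_unit b_unit unitrV.
  case: not_coprime; apply.
    exact: (minimal_left_coprime R_edd detA S_G u_unit def_uA).
  exact: (minimal_right_coprime R_edd detA S_G u_unit def_uA).
have psi_ratio_nonunit : ~ frac_unit psi_ratio.
  by rewrite psi_ratioE frac_unitE; apply/negP.
split=> //.
- split=> //; apply: NNPP => none; apply: psi_ratio_nonunit.
  (* The factor [wn] compensates for extending the denominator from [g] to [n]. *)
  have -> : psi_ratio = (\prod_(1 <= i < n.+1) ((tpsi i)%:F / (psi i)%:F)) * wn%:F.
    rewrite prodf_div -!rmorph_prod psi_prod_n /= tofracM invfM mulrA.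
    rewrite /psi_ratio mulrAC; congr (_ / _); rewrite mulfVK // tofrac_eq0.
    by apply: contraTneq wn_unit => ->; rewrite unitr0.
  apply: frac_unit_mul; last by exists wn.
  apply: frac_unit_prod => i i_range; apply: NNPP => nunit.
  by apply: none; exists i.
- rewrite psi_ratioE eps_ratioE; exists a, b; split=> //.
  have [c /cancel_prods eq_wb] := zero_prod_dvd detA S_G S_P.
  by exists (w^-1 * (c * wr)); rewrite -mulrA -eq_wb mulKr.
move=> def_r def_p; subst p m.
have [c c_unit /cancel_prods eq_wb] := zero_prod_assoc detA S_G S_P.
have ac_assoc : frac_assoc eps_ratio psi_ratio.
  exists (w / (c * wr)); first by rewrite !(unitrM, unitrV) w_unit c_unit.
  rewrite psi_ratioE eps_ratioE -tofracM mulrAC eq_wb [c * wr * a]mulrC mulrK //.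
  by rewrite unitrM c_unit.
(* If all listed zeros and quotients were units, so would be their product [a], and then its
   associate [b]. *)
split=> //; apply: NNPP => none; case/negP: b_nonunit.
suff a_unit : a \is a GRing.unit.
  have : w * b \is a GRing.unit by rewrite eq_wb !unitrM c_unit wr_unit.
  by rewrite unitrM => /andP[].
apply/frac_unitE; rewrite -eps_ratioE /eps_ratio prod_nat_addn tofracM -mulrA.
rewrite !rmorph_prod -prodf_div.
apply: frac_unit_mul; apply: frac_unit_prod => i i_range.
  apply/frac_unitE; apply: contra_notT none => nunit; left; by exists i.
by apply: NNPP => nunit; case: none; right; exists i.
Qed.
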